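(* Let $X_1,\ldots,X_k,Y$ be topological vector spaces, and let $A:X_1\times\cdots\times X_k\to Y$ be a $k$-linear (not necessarily continuous) mapping. Let $\mathcal{B}_j$ be a bornology on $X_j$ $(1\leq j\leq k)$. Then the following assertions are equivalent: (a) $A$ is continuous on $\mathcal{B}_j$-sets; (b) given Cauchy $\mathcal{B}_j$-nets $(x^j_\alpha)_{\alpha\in\Gamma}\subset X_j$ $(1\leq j\leq k)$, indexed by a common directed set $\Gamma$, such that at least one of them is null, the net $\left(A(x^1_\alpha,\ldots,x^k_\alpha)\right)_{\alpha\in\Gamma}$ converges to zero in $Y$; (c) given a Cauchy $\mathcal{B}_j$-net $(x^j_\alpha)_{\alpha\in\Gamma}$ in $X_j$ for each $1\leq j\leq k$, indexed by a common directed set $\Gamma$, the net $\left(A(x^1_\alpha,\ldots,x^k_\alpha)\right)_{\alpha\in\Gamma}$ is Cauchy in $Y$.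
   Context: A family $\mathcal{B}$ of subsets of a vector space $X$ is a bornology if: (a) $\mathcal{B}$ covers $X$; (b) $A\in\mathcal{B}$, $D\subset A$ imply $D\in\mathcal{B}$; (c) $A,D\in\mathcal{B}$ imply $A\cup D\in\mathcal{B}$; (d) $A\in\mathcal{B}$ and $\lambda$ a scalar imply $\lambda A\in\mathcal{B}$; (e) $A,D\in\mathcal{B}$ imply $A+D\in\mathcal{B}$. A net $(x_\alpha)_{\alpha\in\Gamma}\subset X$ is a $\mathcal{B}$-net if $\{x_\alpha:\alpha\in\Gamma\}\in\mathcal{B}$. A net is null if it converges to zero. Given bornologies $\mathcal{B}_j$ on the topological vector spaces $X_j$, a $k$-linear mapping $A:X_1\times\cdots\times X_k\to Y$ is continuous on $\mathcal{B}_j$-sets if for all $B_j\in\mathcal{B}_j$ and $x^j\in B_j$ $(1\leq j\leq k)$, and each zero neighbourhood $V$ in $Y$, there are zero neighbourhoods $U_j$ in $X_j$ such that $A(y^1,\ldots,y^k)-A(x^1,\ldots,x^k)\in V$ whenever $y^j\in B_j$ satisfy $y^j-x^j\in U_j$ for $1\leq j\leq k$. *)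

(* Defs.v *)
From mathcomp Require Import all_boot all_order all_algebra.
From mathcomp Require Import boolp classical_sets filter topology tvs.
Set Implicit Arguments.
Unset Strict Implicit.
Unset Printing Implicit Defensive.
Import Order.TTheory GRing.Theory Num.Theory.
Local Open Scope classical_set_scope.
Local Open Scope ring_scope.

Record is_bornology (K : numFieldType) (E : lmodType K) (B : set_system E) :
    Prop := {
  bornology_cover : \bigcup_(A in B) A = [set: E];
  bornology_sub : forall A D : set E, B A -> D `<=` A -> B D;
  bornology_setU : forall A D : set E, B A -> B D -> B (A `|` D);
  bornology_scale : forall (a : K) (A : set E), B A -> B [set a *: x | x in A];
  bornology_add : forall A D : set E, B A -> B D ->
    B [set x + y | x in A & y in D] }.

(* A directed set is a nonempty preordered type in which any two elements have
   an upper bound; antisymmetry is not required. *)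
Record is_directed (G : Type) (le : G -> G -> Prop) : Prop := {
  directed_inhabited : inhabited G;
  directed_refl : forall g, le g g;
  directed_trans : forall g h i, le g h -> le h i -> le g i;
  directed_ub : forall g h, exists2 i, le g i & le h i }.

(* Convergence of a net [x] indexed by [(G, le)] to [l] is
   [x @ tails le --> l]. *)
Definition tails (G : Type) (le : G -> G -> Prop) : set_system G :=
  filter_from [set: G] (fun g => [set h | le g h]).

Definition bornology_net (E : Type) (B : set_system E) (G : Type)
  (x : G -> E) : Prop := B (range x).

Definition null_net (K : numFieldType) (E : topologicalLmodType K) (G : Type)
  (le : G -> G -> Prop) (x : G -> E) : Prop := x @ tails le --> (0 : E).

(* [topologicalLmodType] carries no uniform structure in the library, so
   Cauchy nets are stated for the translation-invariant uniformity whose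
   entourages come from the zero neighbourhoods. *)
Definition cauchy_net (K : numFieldType) (E : topologicalLmodType K)
    (G : Type) (le : G -> G -> Prop) (x : G -> E) : Prop :=
  forall U : set E, nbhs (0 : E) U ->
    exists g0, forall g h, le g0 g -> le g0 h -> U (x g - x h).

(* [dfwith x j u] is the family [x] with its [j]-th entry replaced by [u]. *)
Definition multilinear (K : numFieldType) (k : nat) (X : 'I_k -> lmodType K)
    (Y : lmodType K) (A : (forall j, X j) -> Y) : Prop :=
  forall (x : forall j, X j) (j : 'I_k),
    linear (fun u : X j => A (dfwith x u)).

Definition continuous_on_bornologies (K : numFieldType) (k : nat)
    (X : 'I_k -> topologicalLmodType K) (Y : topologicalLmodType K)
    (B : forall j, set_system (X j)) (A : (forall j, X j) -> Y) : Prop :=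
  forall S : forall j, set (X j), (forall j, B j (S j)) ->
  forall x : forall j, X j, (forall j, S j (x j)) ->
  forall V : set Y, nbhs (0 : Y) V ->
  exists2 U : forall j, set (X j),
    (forall j, nbhs (0 : X j) (U j)) &
    forall y : forall j, X j, (forall j, S j (y j)) ->
      (forall j, U j (y j - x j)) -> V (A y - A x).

(* Main.v *)
Require Import Defs.
From mathcomp Require Import all_boot all_order all_algebra.
From mathcomp Require Import boolp classical_sets filter topology tvs.
Import GRing.Theory.
Local Open Scope classical_set_scope.
Local Open Scope ring_scope.

(** The three assertions are proved equivalent around the cycle
    (a) => (b) => (c) => (a).

    Both (a) => (b) and (b) => (c) rest on the telescoping identity behind
    [telescope_null]: by multilinearity [A x - A y] is the sum over [j] of the
    values of [A] at points whose [j]-th entry is [x j - y j] and whose other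
    entries are taken from [x] or from [y].  Such a difference of nets is
    therefore null as soon as each of these finitely many hybrid nets is mapped
    to a null net.

    (a) => (b).  Continuity on bornological sets controls [A] near one fixed
    point, whereas a Cauchy net need not converge; the way out is an induction
    on the set [N] of coordinates that are only known to be Cauchy, the others
    being convergent, one of them to zero ([continuous_on_bornologies_null]).
    Continuity at the point with entry [0] on [N] and with the limits off [N]
    yields zero neighbourhoods [U j].  Past some index [b] the differences
    [x j g - x j b], for [j] in [N], lie in [U j], so that [A] is small on the
    net obtained from [x] by these replacements.  By telescoping, the error
    committed is a sum of terms in which one coordinate of [N] has become a
    constant, [x j b] up to sign, while the other coordinates of [N] are still
    Cauchy; these terms are null by the induction hypothesis.

    (b) => (c).  Over the product directed set, [x j g - x j h] is a null net
    in [(g, h)], and telescoping [A (x g) - A (x h)] makes it null.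

    (c) => (a).  The points [y] of the product of the given sets, each paired
    with a family of zero neighbourhoods containing [y - x], are directed by
    reverse inclusion of the neighbourhoods and form Cauchy nets converging to
    [x].  As [x] itself occurs at arbitrarily large indices, the Cauchy
    property of the image net gives continuity at [x]. *)

(** * Zero neighbourhoods and nets *)

Section Nets.
Context {K : numFieldType}.

Lemma nbhs0_sub {E : topologicalLmodType K} {V : set E} : nbhs (0 : E) V ->
  exists2 W : set E, nbhs (0 : E) W & forall a b, W a -> W b -> V (a - b).
Proof.
move=> V0; have /= := @sub_continuous E (0, 0) V.
rewrite subr0 => /(_ V0)[[P Q] [/= P0 Q0] PQ].
exists (P `&` Q) => [|a b [Pa _] [_ Qb]]; first exact: filterI.
exact: (PQ (a, b)).
Qed.

Context {G : Type} {le : G -> G -> Prop} (dle : is_directed le).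

Lemma tails_filter : Filter (tails le).
Proof.
apply: filter_from_filter => [|g h _ _].
  by have [[g]] := dle; exists g.
have [i gi hi] := directed_ub dle g h.
by exists i => // l il; split; exact: directed_trans il.
Qed.

Lemma tails_fin_ub {I : finType} (g : I -> G) : exists h, forall i, le (g i) h.
Proof.
have FF := tails_filter.
have [h _ hP] : tails le [set h | forall i, le (g i) h].
  apply: (@filter_forall _ _ (fun i => [set h | le (g i) h]) _ FF) => i.
  by exists (g i).
by exists h; apply: hP; exact: directed_refl.
Qed.

Lemma null_netB {E : topologicalLmodType K} {x y : G -> E} :
  null_net le x -> null_net le y -> null_net le (fun g => x g - y g).
Proof.
move=> x0 y0 V /nbhs0_sub[W W0 WV]; have FF := tails_filter.
have := @filterS2 _ _ FF (x @^-1` W) (y @^-1` W) ((fun g => x g - y g) @^-1` V).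
by apply; [move=> g; exact: WV|exact: x0|exact: y0].
Qed.

Lemma null_net0 {E : topologicalLmodType K} : null_net le (fun=> 0 : E).
Proof. by have FF := tails_filter; exact: cvg_cst. Qed.

Lemma null_net_ext {E : topologicalLmodType K} {x y : G -> E} :
  x =1 y -> null_net le x -> null_net le y.
Proof. by move=> /funext ->. Qed.

Lemma null_net_cauchy {E : topologicalLmodType K} {x : G -> E} :
  null_net le x -> cauchy_net le x.
Proof.
move=> x0 U /nbhs0_sub[W /x0[g0 _ xW] WU].
by exists g0 => g h g0g g0h; apply: WU; exact: xW.
Qed.

Lemma cauchy_net_sub_cst {E : topologicalLmodType K} {x : G -> E} (a : E) :
  cauchy_net le x -> cauchy_net le (fun g => x g - a).
Proof.
move=> xC U /xC[g0 xU]; exists g0 => g h g0g g0h.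
by rewrite opprB addrA subrK; exact: xU.
Qed.

End Nets.

Section Bornology.
Context {K : numFieldType} {E : lmodType K} {B : set_system E}
  (bB : is_bornology B).

Lemma bornology_set1 (a : E) : B [set a].
Proof.
have : [set: E] a by [].
rewrite -(bornology_cover bB) => -[D BD Da].
by apply: (bornology_sub bB BD) => _ ->.
Qed.

Lemma bornology_diff {A D : set E} : B A -> B D ->
  B [set u - v | u in A & v in D].
Proof.
move=> BA BD; have := bornology_add bB BA (bornology_scale bB (-1) BD).
move=> BAD; apply: (bornology_sub bB BAD) => _ [u Au [v Dv <-]].
by exists u => //; exists (- v) => //; exists v => //; rewrite scaleN1r.
Qed.

Lemma bornology_net_in {G : Type} {x : G -> E} {D : set E} :
  B D -> (forall g, D (x g)) -> bornology_net B x.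
Proof. by move=> BD xD; apply: (bornology_sub bB BD) => _ [g _ <-]. Qed.

Lemma bornology_net_sub_cst {G : Type} {x : G -> E} (a : E) :
  bornology_net B x -> bornology_net B (fun g => x g - a).
Proof.
move=> Bx.
apply: bornology_net_in (bornology_diff Bx (bornology_set1 a)) _ => g.
by exists (x g); [exists g|exists a].
Qed.

End Bornology.

(** * Multilinear maps and telescoping *)

Section Multilinear.
Context {K : numFieldType} {k : nat} {X : 'I_k -> topologicalLmodType K}
  {Y : topologicalLmodType K} {A : (forall j, X j) -> Y}
  (A_multilinear : multilinear A).

(** Additivity in the [j]-th entry, phrased through agreement off [j] so that
    it applies to points not syntactically of the form [dfwith]. *)
Lemma multilinear_sub {j : 'I_k} {x y z : forall i, X i} :
  z j = x j - y j -> (forall i, i != j -> z i = x i) ->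
  (forall i, i != j -> z i = y i) -> A z = A x - A y.
Proof.
move=> zj zx zy; have zE (t : forall i, X i) :
    (forall i, i != j -> z i = t i) -> t = dfwith z (t j).
  move=> zt; apply: functional_extensionality_dep => i.
  by case: dfwithP => // l; rewrite eq_sym => /zt.
rewrite (zE z)// (zE x zx) (zE y zy) zj {2 3}/dfwith.
have := A_multilinear z j (-1) (y j) (x j).
by rewrite /= !scaleN1r ![- _ + _]addrC.
Qed.

Lemma multilinear0 {j : 'I_k} {x : forall i, X i} : x j = 0 -> A x = 0.
Proof.
by move=> xj; rewrite (@multilinear_sub j x x x)// ?subrr ?xj ?subr0.
Qed.

(** Replacing the entries of [y] by those of [x] one at a time, each step
    changes [A] by the value at a hybrid [z].  The hypothesis does not record
    which entries of [z] come from [x] and which from [y], so that users need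
    no order on the coordinates. *)
Lemma telescope_null {G : Type} {le : G -> G -> Prop} (dle : is_directed le)
    {x y : forall j, G -> X j} :
  (forall (j : 'I_k) (z : forall i, G -> X i),
    (forall g, z j g = x j g - y j g) ->
    (forall i, i != j -> z i = x i \/ z i = y i) ->
    null_net le (fun g => A (fun i => z i g))) ->
  null_net le (fun g => A (fun i => x i g) - A (fun i => y i g)).
Proof.
move=> Az0.
pose hyb (m : nat) : forall i, G -> X i :=
  fun i => if (i < m)%N then x i else y i.
have hybx : hyb k = x.
  by apply: functional_extensionality_dep => i; rewrite /hyb ltn_ord.
have /(_ k (leqnn k)) : forall m, (m <= k)%N ->
    null_net le (fun g => A (fun i => hyb m i g) - A (fun i => y i g)).
  elim=> [_|m IHm mk].
    apply: null_net_ext (null_net0 dle) => g; apply/esym/eqP.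
    by rewrite subr_eq0.
  pose j := Ordinal mk.
  pose z := dfwith (hyb m) (fun g => x j g - y j g).
  have /Az0 z0 g : z j g = x j g - y j g by rewrite /z dfwith_in.
  have {}z0 : null_net le (fun g => A (fun i => z i g)).
    apply: z0 => i ij; rewrite /z dfwith_out 1?eq_sym// /hyb.
    by case: ifP; [left|right].
  have := null_netB dle z0 (null_netB dle (null_net0 dle) (IHm (ltnW mk))).
  apply: null_net_ext => g; rewrite sub0r opprK addrA; congr (_ - _).
  rewrite (@multilinear_sub j (fun i => hyb m.+1 i g) (fun i => hyb m i g)).
  - by rewrite subrK.
  - by rewrite /z dfwith_in /hyb /= ltnS leqnn ltnn.
  - move=> i ij; rewrite /z dfwith_out 1?eq_sym// /hyb ltnS (leq_eqVlt i m).
    by rewrite (negbTE (ij : i != m :> nat)).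
  - by move=> i ij; rewrite /z dfwith_out 1?eq_sym.
by rewrite hybx.
Qed.

Context {B : forall j, set_system (X j)}
  (B_bornology : forall j, is_bornology (B j)).

(** * From continuity on bornological sets to null nets *)

(** Expanding around [x j b] for all [j] at once would bring in points at which
    continuity has to be invoked again with new, smaller neighbourhoods, hence
    a new [b].  The induction on [N] organises these successive choices: it
    allows convergent coordinates next to Cauchy ones, and each round turns one
    Cauchy coordinate into a constant one. *)
Lemma continuous_on_bornologies_null {G : Type} {le : G -> G -> Prop}
    (dle : is_directed le) (N : {set 'I_k}) (x : forall j, G -> X j)
    (c : forall j, X j) :
  continuous_on_bornologies B A ->
  (forall j, bornology_net (B j) (x j)) ->
  (forall j, j \in N -> cauchy_net le (x j)) ->
  (forall j, j \notin N -> null_net le (fun g => x j g - c j)) ->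
  (exists2 j, j \notin N & c j = 0) ->
  null_net le (fun g => A (fun j => x j g)).
Proof.
move=> Acont; have FF := tails_filter dle.
have [n] := ubnP #|N|; elim: n => // n IHn in N x c *.
rewrite ltnS => Nn xB xC xc [j0 j0N cj0] V /nbhs0_sub[W W0 WV].
pose p j : X j := if j \in N then 0 else c j.
(* [S j] contains [range (x j)] and its differences because the neighbourhoods
   [U] must be obtained before the index [b] that depends on them. *)
pose S j := range (x j) `|` [set u - v | u in range (x j) & v in range (x j)]
  `|` [set p j].
have SB j : B j (S j).
  have bj := B_bornology j.
  apply: (bornology_setU bj); last exact: bornology_set1.
  apply: (bornology_setU bj); first exact: xB.
  by apply: bornology_diff => //; exact: xB.
have [|U U0 UW] := Acont S SB p _ W W0; first by move=> j; right.
have /choice[b_ b_P] : forall j, exists b, j \in N ->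
    forall g h, le b g -> le b h -> U j (x j g - x j h).
  move=> j; case: (boolP (j \in N)) => [/xC/(_ _ (U0 j))[b bP]|_].
    by exists b.
  by have [[b]] := dle; exists b.
have [b bP] := tails_fin_ub dle b_.
pose y j : G -> X j := fun g => if j \in N then x j g - x j b else x j g.
have yW : \forall g \near tails le, W (A (fun j => y j g)).
  have Ap : A p = 0 by apply: (@multilinear0 j0); rewrite /p (negbTE j0N).
  have /(@filter_forall _ _ _ _ FF) yU j :
      \forall g \near tails le, U j (y j g - p j).
    rewrite /y /p; case: (boolP (j \in N)) => [jN|/xc]; last exact.
    exists b => // g bg; rewrite subr0; apply: b_P => //.
    exact: directed_trans bg.
  apply: filterS yU => g yU; rewrite -[A _]subr0 -Ap; apply: UW => // j.
  left; rewrite /y; case: ifP => _; [right|by left; exists g].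
  by exists (x j g); [exists g|exists (x j b); [exists b|]].
have /(_ _ W0) xyW :
    null_net le (fun g => A (fun j => y j g) - A (fun j => x j g)).
  apply: telescope_null => // j z zj zi.
  case: (boolP (j \in N)) => jN; last first.
    apply: null_net_ext (null_net0 dle) => g; apply/esym/(@multilinear0 j).
    by rewrite zj /y (negbTE jN) subrr.
  have zjE g : z j g = - x j b by rewrite zj /y jN addrAC subrr sub0r.
  have ziE i : i \in N -> i != j ->
      z i = x i \/ z i = (fun g => x i g - x i b).
    by move=> iN /zi[]->; [right; rewrite /y iN|left].
  have ziC i : i \notin N -> z i = x i.
    move=> iN; have /zi[->|//] : i != j by apply: contraNneq iN => ->.
    by rewrite /y (negbTE iN).
  apply: (IHn (N :\ j)%SET z (dfwith c (- x j b))).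
  - by move: Nn; rewrite (cardsD1 j N) jN.
  - move=> i; have [->|ij] := eqVneq i j.
      have bj := B_bornology j.
      exact: (bornology_net_in bj (bornology_set1 bj (- x j b))).
    have [iN|/ziC-> //] := boolP (i \in N).
    have [->|->] := ziE _ iN ij; first exact: xB.
    by apply: bornology_net_sub_cst; [exact: B_bornology|exact: xB].
  - move=> i; rewrite !inE => /andP[ij iN].
    have [->|->] := ziE _ iN ij; first exact: xC.
    by apply: cauchy_net_sub_cst; exact: xC.
  - move=> i; rewrite !inE negb_and negbK.
    have [->|ij] := eqVneq i j => /= [_|iN].
      apply: null_net_ext (null_net0 dle) => g.
      by rewrite dfwith_in zjE subrr.
    by rewrite ziC// dfwith_out 1?eq_sym//; exact: xc.
  - exists j0; first by rewrite !inE (negbTE j0N) andbF.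
    by rewrite dfwith_out//; apply: contraNneq j0N => <-.
apply: filterS2 yW xyW => g yW xyW.
have := WV _ _ yW xyW; rewrite opprB addrCA subrr addr0; exact.
Qed.

End Multilinear.

(** * Products of directed sets *)

Section ProductIndex.
Context {G : Type} {le : G -> G -> Prop} (dle : is_directed le).

(** Letting the two indices vary independently turns the Cauchy property into
    convergence of the differences to zero. *)
Definition prod_le (p q : G * G) : Prop := le p.1 q.1 /\ le p.2 q.2.

Lemma prod_le_directed : is_directed prod_le.
Proof.
split.
- by have [[g]] := dle; exists; exact: (g, g).
- by move=> p; split; exact: directed_refl.
- move=> p q r [pq1 pq2] [qr1 qr2].
  by split; [exact: directed_trans pq1 qr1|exact: directed_trans pq2 qr2].
- move=> [g1 g2] [h1 h2]; have [i1 gi1 hi1] := directed_ub dle g1 h1.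
  by have [i2 gi2 hi2] := directed_ub dle g2 h2; exists (i1, i2).
Qed.

Context {K : numFieldType} {E : topologicalLmodType K} {x : G -> E}
  (xC : cauchy_net le x).

Lemma cauchy_net_fst : cauchy_net prod_le (fun p => x p.1).
Proof.
by move=> U /xC[g xU]; exists (g, g) => p q [? _] [? _]; exact: xU.
Qed.

Lemma cauchy_net_snd : cauchy_net prod_le (fun p => x p.2).
Proof.
by move=> U /xC[g xU]; exists (g, g) => p q [_ ?] [_ ?]; exact: xU.
Qed.

Lemma cauchy_net_diff_null : null_net prod_le (fun p => x p.1 - x p.2).
Proof. by move=> U /xC[g xU]; exists (g, g) => // p [? ?]; exact: xU. Qed.

End ProductIndex.

Lemma null_net_diff_cauchy {K : numFieldType} {E : topologicalLmodType K}
    {G : Type} {le : G -> G -> Prop} (dle : is_directed le) {x : G -> E} :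
  null_net (prod_le (le := le)) (fun p => x p.1 - x p.2) -> cauchy_net le x.
Proof.
move=> x0 U /x0[[g h] _ xU]; have [i gi hi] := directed_ub dle g h.
exists i => l m il im; apply: (xU (l, m)).
by split; [exact: directed_trans gi il|exact: directed_trans hi im].
Qed.

(** * The directed set of points approaching a given point *)

Section Approach.
Context {K : numFieldType} {k : nat} {X : 'I_k -> topologicalLmodType K}
  {S : forall j, set (X j)} {x : forall j, X j} (Sx : forall j, S j (x j)).

(** Keeping the neighbourhoods in the index makes the order directed: a point
    alone would not record how close to [x] the later points must be. *)
Record approach := Approach {
  approach_nbhs : forall j, set (X j);
  approach_pt : forall j, X j;
  approach_nbhsP : forall j, nbhs (0 : X j) (approach_nbhs j);
  approach_ptP : forall j, S j (approach_pt j);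
  approach_near : forall j, approach_nbhs j (approach_pt j - x j) }.

Definition approach_le (p q : approach) : Prop :=
  forall j, approach_nbhs q j `<=` approach_nbhs p j.

Lemma nbhs_sub_self {U : forall j, set (X j)} :
  (forall j, nbhs (0 : X j) (U j)) -> forall j, U j (x j - x j).
Proof. by move=> U0 j; rewrite subrr; exact: (nbhs_singleton (U0 j)). Qed.

(** [x] occurs with every family of neighbourhoods; this gives upper bounds,
    and lets the Cauchy property compare any late point with [x] itself. *)
Definition approach_self {U : forall j, set (X j)}
    (U0 : forall j, nbhs (0 : X j) (U j)) : approach :=
  Approach _ _ U0 Sx (nbhs_sub_self U0).

Lemma approach_directed : is_directed approach_le.
Proof.
split.
- by exists; apply: (@approach_self (fun=> setT)) => j; exact: filterT.
- by move=> p j.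
- by move=> p q r pq qr j; exact: subset_trans (qr j) (pq j).
- move=> p q.
  have pq0 j : nbhs (0 : X j) (approach_nbhs p j `&` approach_nbhs q j).
    by apply: filterI; exact: approach_nbhsP.
  by exists (approach_self pq0) => j u [].
Qed.

Lemma approach_cauchy (j : 'I_k) :
  cauchy_net approach_le (fun p => approach_pt p j).
Proof.
move=> U /nbhs0_sub[W W0 WU].
have W'0 i : nbhs (0 : X i) (dfwith (fun=> setT : set (X _)) W i).
  by case: dfwithP => // *; exact: filterT.
exists (approach_self W'0) => p q /(_ j) pW /(_ j) qW.
rewrite /= dfwith_in in pW qW.
have := WU _ _ (pW _ (approach_near p j)) (qW _ (approach_near q j)).
by rewrite opprB addrA subrK.
Qed.

End Approach.

Theorem theorem3 (K : numFieldType) (k : nat) (k_gt0 : (0 < k)%N)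
    (X : 'I_k -> topologicalLmodType K) (Y : topologicalLmodType K)
    (A : (forall j, X j) -> Y) (A_multilinear : multilinear A)
    (B : forall j, set_system (X j))
    (B_bornology : forall j, is_bornology (B j)) :
  let assertion_a := continuous_on_bornologies B A in
  let assertion_b :=
    forall (G : Type) (le : G -> G -> Prop), is_directed le ->
    forall x : (forall j, G -> X j),
      (forall j, bornology_net (B j) (x j)) ->
      (forall j, cauchy_net le (x j)) ->
      (exists j, null_net le (x j)) ->
      null_net le (fun g => A (fun j => x j g)) in
  let assertion_c :=
    forall (G : Type) (le : G -> G -> Prop), is_directed le ->
    forall x : (forall j, G -> X j),
      (forall j, bornology_net (B j) (x j)) ->
      (forall j, cauchy_net le (x j)) ->
      cauchy_net le (fun g => A (fun j => x j g)) in
  (assertion_a <-> assertion_b) /\ (assertion_b <-> assertion_c).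
Proof.
move=> assertion_a assertion_b assertion_c.
have ab : assertion_a -> assertion_b.
  move=> Acont G le dle x xB xC [j0 x0].
  apply: (continuous_on_bornologies_null A_multilinear B_bornology dle
    [set~ j0]%SET x (fun=> 0)) => // [j|].
    by rewrite !inE negbK => /eqP->; apply: null_net_ext x0 => g; rewrite subr0.
  by exists j0 => //; rewrite !inE eqxx.
have bc : assertion_b -> assertion_c.
  move=> b G le dle x xB xC; apply: null_net_diff_cauchy => //.
  apply: (telescope_null A_multilinear (prod_le_directed dle)
    (x := fun j p => x j p.1) (y := fun j p => x j p.2)) => j z /funext zj zi.
  have zB i : bornology_net (B i) (z i).
    have [->|/zi[]->] := eqVneq i j.
    - have bj := B_bornology j.
      have := bornology_diff bj (xB j) (xB j).
      rewrite zj => /(bornology_net_in bj); apply => -[g h].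
      by exists (x j g); [exists g|exists (x j h); [exists h|]].
    - by apply: (bornology_net_in (B_bornology i) (xB i)) => p; exists p.1.
    - by apply: (bornology_net_in (B_bornology i) (xB i)) => p; exists p.2.
  have z0 : null_net (prod_le (le := le)) (z j).
    by rewrite zj; exact: cauchy_net_diff_null.
  apply: b => //; [exact: prod_le_directed| |by exists j].
  move=> i; have [->|/zi[]->] := eqVneq i j.
  - exact: null_net_cauchy.
  - exact: cauchy_net_fst.
  - exact: cauchy_net_snd.
have ca : assertion_c -> assertion_a.
  move=> c S SB x Sx V V0.
  have [||p0 p0P] := c _ _ (approach_directed Sx)
    (fun j p => approach_pt p j) _ _ V V0.
  - move=> j; apply: (bornology_net_in (B_bornology j) (SB j)) => p.
    exact: approach_ptP.
  - by move=> j; exact: approach_cauchy.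
  exists (approach_nbhs p0) => [|y Sy yU]; first exact: (approach_nbhsP p0).
  pose q := Approach _ _ (approach_nbhsP p0) Sy yU.
  by apply: (p0P q (approach_self Sx (approach_nbhsP p0))) => j.
by split; split; auto.
Qed.
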